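(* Let $A$ be a commutative Noetherian ring and let $I$ and $J$ be ideals of $A$. The following chain of inclusions holds: $$\bigl(\operatorname{Ass}_A(A/I)\cup\operatorname{Ass}_A(A/J)\bigr)\setminus\operatorname{Ass}_A(A/(I+J))\subseteq\operatorname{Ass}_A(A/(I\cap J))\subseteq\operatorname{Ass}_A(A/I)\cup\operatorname{Ass}_A(A/J).$$
   Context: $\operatorname{Ass}_A(M)$ denotes the set of associated primes of an $A$-module $M$. *)

(* Defs.v *)
From HB Require Import structures.
From mathcomp Require Import all_boot all_algebra.
From mathcomp Require Import boolp classical_sets.

Set Implicit Arguments.
Unset Strict Implicit.
Unset Printing Implicit Defensive.

Import GRing.Theory.

Local Open Scope ring_scope.
Local Open Scope quotient_scope.

Section QuotientModule.
Variables (A : pzRingType) (V : lmodType A) (W : submodClosed V).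

Definition submod_zmod : {pred V} := [pred v | v \in W].

Lemma submod_zmod_closed : zmod_closed submod_zmod.
Proof. exact: GRing.submod_closedB (GRing.submodClosedP W). Qed.

HB.instance Definition _ :=
  GRing.isZmodClosed.Build V submod_zmod submod_zmod_closed.

(* The quotient V / W: the additive quotient group of [ring_quotient], with
   the induced scaling. *)
Definition quot_module : Type := Quotient.quot submod_zmod.

HB.instance Definition _ := GRing.Zmodule.on quot_module.
HB.instance Definition _ :=
  EqQuotient.copy quot_module (Quotient.quot submod_zmod).

Lemma pi_quot_moduleB (u v : V) :
  (u == v %[mod quot_module]) = (u - v \in W).
Proof. by rewrite -[LHS](Quotient.idealrBE submod_zmod). Qed.

Lemma pi_quot_moduleD :
  {morph \pi_quot_module : u v / u + v >-> u + v}.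
Proof. exact: (@Quotient.pi_add V submod_zmod). Qed.

Definition quot_scale (a : A) (v : quot_module) : quot_module :=
  \pi_quot_module (a *: repr v).

Lemma pi_quot_scale (a : A) (v : V) :
  quot_scale a (\pi_quot_module v) = \pi_quot_module (a *: v).
Proof.
apply/eqP; rewrite pi_quot_moduleB -scalerBr rpredZ //.
by rewrite -pi_quot_moduleB reprK.
Qed.

Lemma quot_scalerA a b v : quot_scale a (quot_scale b v) = quot_scale (a * b) v.
Proof. by elim/quotW: v => v; rewrite (pi_quot_scale b) !pi_quot_scale scalerA. Qed.

Lemma quot_scale1r : left_id 1 quot_scale.
Proof. by elim/quotW=> v; rewrite pi_quot_scale scale1r. Qed.

Lemma quot_scalerDr : right_distributive quot_scale +%R.
Proof.
move=> a; elim/quotW=> u; elim/quotW=> v.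
by rewrite -pi_quot_moduleD !pi_quot_scale scalerDr pi_quot_moduleD.
Qed.

Lemma quot_scalerDl v : {morph quot_scale^~ v : a b / a + b}.
Proof.
elim/quotW: v => v a b.
by rewrite !pi_quot_scale scalerDl pi_quot_moduleD.
Qed.

HB.instance Definition _ := GRing.Zmodule_isLmodule.Build A quot_module
  quot_scalerA quot_scale1r quot_scalerDr quot_scalerDl.

Lemma pi_quot_moduleZ (a : A) (v : V) :
  \pi_quot_module (a *: v) = a *: \pi_quot_module v.
Proof. by rewrite -pi_quot_scale. Qed.
End QuotientModule.

(* Ideals are the submodules of the regular module A^o. Unlike [idealr], they
   may be the whole ring. Membership is boolean, which is no restriction given
   the classical axioms of [boolp]. *)
Notation ideal A := (submodClosed A^o).

Section Ideals.
Variable A : comPzRingType.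
Implicit Types I J P : ideal A.

Definition cap_pred I J : {pred A^o} := [pred x | (x \in I) && (x \in J)].

Lemma cap_pred_submod_closed I J : submod_closed (cap_pred I J).
Proof.
split=> [|a x y]; first by rewrite inE !rpred0.
rewrite !inE => /andP[xI xJ] /andP[yI yJ].
by apply/andP; split; rewrite rpredD // rpredZ.
Qed.

HB.instance Definition _ I J :=
  GRing.isSubmodClosed.Build A A^o (cap_pred I J) (cap_pred_submod_closed I J).

Definition ideal_cap I J : ideal A := cap_pred I J.

Lemma in_ideal_cap I J x : (x \in ideal_cap I J) = (x \in I) && (x \in J).
Proof. by []. Qed.

Definition add_pred I J : {pred A^o} :=
  [pred x | `[< exists2 y, y \in I & exists2 z, z \in J & x = y + z >]].

Lemma add_predP I J x :
  reflect (exists2 y, y \in I & exists2 z, z \in J & x = y + z)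
          (x \in add_pred I J).
Proof. exact: asboolP. Qed.

Lemma add_pred_submod_closed I J : submod_closed (add_pred I J).
Proof.
split=> [|a x y].
  apply/add_predP; exists 0; first exact: (rpred0 I).
  by exists 0; [exact: (rpred0 J) | rewrite addr0].
move=> /add_predP[x1 x1I [x2 x2J ->]] /add_predP[y1 y1I [y2 y2J ->]].
apply/add_predP; exists (a *: (x1 : A^o) + y1); first by rewrite rpredD ?rpredZ.
exists (a *: (x2 : A^o) + y2); first by rewrite rpredD ?rpredZ.
by rewrite (scalerDr a (x1 : A^o) x2) addrACA.
Qed.

HB.instance Definition _ I J :=
  GRing.isSubmodClosed.Build A A^o (add_pred I J) (add_pred_submod_closed I J).

Definition ideal_add I J : ideal A := add_pred I J.

Lemma ideal_addP I J x :
  reflect (exists2 y, y \in I & exists2 z, z \in J & x = y + z)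
          (x \in ideal_add I J).
Proof. exact: add_predP. Qed.

Definition prime_ideal P : Prop :=
  1 \notin P /\ forall a b : A, a * b \in P -> (a \in P) || (b \in P).

End Ideals.

Definition noetherian (A : comPzRingType) : Prop :=
  forall I : ideal A, exists (n : nat) (g : 'I_n -> A),
    forall x : A, x \in I <-> exists c : 'I_n -> A, x = \sum_(i < n) c i * g i.

Section AssociatedPrimes.
Variables (A : comPzRingType) (M : lmodType A).

Definition ann (m : M) : {pred A} := [pred a : A | a *: m == 0].

Definition Ass : set (ideal A) :=
  [set P | prime_ideal P /\ exists m : M, P =i ann m]%classic.

End AssociatedPrimes.

(* Main.v *)
Require Import Defs.
From mathcomp Require Import all_boot all_algebra.
From mathcomp Require Import boolp classical_sets.

(* The first inclusion comes from the exact sequence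
     0 -> A/(I cap J) -> A/I (+) A/J -> A/(I + J) -> 0.
   Let P = (I : m) be prime. If a m = i + j lies in I + J for some a outside P,
   then P = (I : a m) = (I : j) = (I cap J : j); otherwise P = (I + J : m).
   For the second one, (I cap J : m) = (I : m) cap (J : m), and a prime ideal
   which is the intersection of two ideals is equal to one of them. *)

Import GRing.Theory.

Local Open Scope ring_scope.
Local Open Scope quotient_scope.
Local Open Scope classical_set_scope.

Lemma pi_quot_module_eq0 (A : pzRingType) (V : lmodType A)
    (W : submodClosed V) (v : V) :
  (\pi_(quot_module W) v == 0) = (v \in W).
Proof.
(* Zero, written as a multiple of the class of [v], becomes the class of [0 *: v], and two classes
   can then be compared. *)
rewrite -[X in _ == X](scale0r (\pi_(quot_module W) v)) -pi_quot_moduleZ.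
by rewrite scale0r pi_quot_moduleB subr0.
Qed.

Section AssQuotients.
Variable A : comPzRingType.
Implicit Types (I J P : ideal A) (a m : A).

Lemma ideal_mull I a m : m \in I -> a * m \in I.
Proof. exact: (@rpredZ A A^o I a m). Qed.

(** Every element of A/I is the class of some [m], whose annihilator is the colon ideal (I : m).
    From here on, only membership in ideals matters. *)
Lemma Ass_quotP I P :
  Ass (quot_module I) P <->
  prime_ideal P /\ exists m, forall a, (a \in P) = (a * m \in I).
Proof.
have annE m a : (a \in ann (\pi_(quot_module I) (m : A^o))) = (a * m \in I).
  by rewrite inE -pi_quot_moduleZ pi_quot_module_eq0.
split=> -[primeP [m Pm]]; split=> //.
  exists (repr m) => a; rewrite -annE reprK; exact: Pm.
by exists (\pi_(quot_module I) (m : A^o)) => a; rewrite annE Pm.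
Qed.

(** Ideals with the same elements may differ as terms, and so may their quotient types; this
    transports associated primes between them. *)
Lemma Ass_quot_sub I J : I =i J ->
  Ass (quot_module I) `<=` Ass (quot_module J).
Proof.
move=> eqI P /Ass_quotP[primeP [m Pm]]; apply/Ass_quotP; split=> //.
by exists m => a; rewrite -eqI.
Qed.

Lemma ideal_addC I J : ideal_add I J =i ideal_add J I.
Proof.
move=> x; apply/ideal_addP/ideal_addP => -[y yI [z zJ ->]];
  by exists z => //; exists y => //; rewrite addrC.
Qed.

Lemma ideal_capC I J : ideal_cap I J =i ideal_cap J I.
Proof. by move=> x; rewrite !in_ideal_cap andbC. Qed.

Lemma Ass_quot_subl I J :
  Ass (quot_module I) `<=`
    Ass (quot_module (ideal_cap I J)) `|` Ass (quot_module (ideal_add I J)).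
Proof.
move=> P /Ass_quotP[primeP [m Pm]].
have [[a aNP /ideal_addP[i iI [j jJ amE]]]|no_a] :=
  pselect (exists2 a, a \notin P & a * m \in ideal_add I J).
  left; apply/Ass_quotP; split=> //; exists j => b.
  rewrite in_ideal_cap (ideal_mull J) // andbT.
  (* As b i lies in I, b j is in I exactly when b a m is. *)
  have -> : (b * j \in I) = (b * a \in P).
    rewrite Pm -mulrA amE mulrDr; apply: esym.
    exact/(@rpredDl A^o (submod_zmod I))/ideal_mull.
  apply/idP/idP => [bP|/primeP.2/orP[]//]; last by rewrite (negPf aNP).
  by rewrite mulrC ideal_mull.
right; apply/Ass_quotP; split=> //; exists m => a; apply/idP/idP => [|amIJ].
  rewrite Pm => amI; apply/ideal_addP; exists (a * m) => //.
  by exists 0; [exact: (rpred0 J) | rewrite addr0].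
by apply: contrapT => /negP aNP; apply: no_a; exists a.
Qed.

Lemma Ass_quot_cap I J :
  Ass (quot_module (ideal_cap I J)) `<=`
    Ass (quot_module I) `|` Ass (quot_module J).
Proof.
move=> P /Ass_quotP[primeP [m Pm]].
have [IP|/existsNP[a /not_implyP[aI /negP aNP]]] :=
  pselect (forall a, a * m \in I -> a \in P).
  left; apply/Ass_quotP; split=> //; exists m => a; apply/idP/idP; last exact: IP.
  by rewrite Pm in_ideal_cap => /andP[].
right; apply/Ass_quotP; split=> //; exists m => b; apply/idP/idP => [|bJ].
  by rewrite Pm in_ideal_cap => /andP[].
(* a m is in I and b m is in J, so a b m lies in both; since [a] is outside P, primality then puts
   [b] in P. *)
have abP : a * b \in P.
  rewrite Pm in_ideal_cap -mulrA (ideal_mull J) // andbT.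
  by rewrite mulrA (mulrC a) -mulrA ideal_mull.
by have /orP[aP|] := primeP.2 a b abP; first by rewrite aP in aNP.
Qed.

End AssQuotients.

Theorem proposition3p5 (A : comPzRingType) (hA : noetherian A) (I J : ideal A) :
  (Ass (quot_module I) `|` Ass (quot_module J))
      `\` Ass (quot_module (ideal_add I J))
    `<=` Ass (quot_module (ideal_cap I J))
  /\
  Ass (quot_module (ideal_cap I J))
    `<=` Ass (quot_module I) `|` Ass (quot_module J).
Proof.
split; last exact: Ass_quot_cap.
(* The two cases left come from A/J, with I and J swapped in the intersection and in the sum. *)
move=> P [[/(Ass_quot_subl _ _ J)|/(Ass_quot_subl _ _ I)] [] // PJI NP].
  exact: Ass_quot_sub (ideal_capC _ _ _) _ PJI.
by case: NP; apply: Ass_quot_sub (ideal_addC _ _ _) _ PJI.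
Qed.
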